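(* Let $p$ and $p^*$ be measurable transition densities on $\mathbb{R}\times X$, let $q\colon\mathbb{R}\times X\to[0,\infty]$ be measurable, let $C\ge 1$, let $Q$ be regular superadditive, and let $0\le\eta<1$. If $q\in\mathcal{N}(p,p^*,C,\eta,Q)$, then for all $s<t$, $x,y\in X$ and $0<\varepsilon<1-\eta$, $$\tilde p(s,x,t,y)\le p^*(s,x,t,y)\left(\frac{C}{1-\eta-\varepsilon}\right)^{1+\frac{Q(s,t)}{\varepsilon}},$$ where $\tilde p$ is the Schrödinger perturbation of $p$ by $q$.
   Context: $X$ is an arbitrary set with a $\sigma$-algebra $\mathcal{M}$ and a (non-negative) $\sigma$-finite measure $m$ on $\mathcal{M}$; write $dz$ for $m(dz)$. $\mathbb{R}$ carries its Borel sets $\mathcal{B}$ and Lebesgue measure $du$; space-time $\mathbb{R}\times X$ carries the $\sigma$-algebra $\mathcal{B}\times\mathcal{M}$ and the product measure $du\,dz$. A measurable transition density is a $\mathcal{B}\times\mathcal{M}\times\mathcal{B}\times\mathcal{M}$-measurable function $p\colon\mathbb{R}\times X\times\mathbb{R}\times X\to[0,\infty]$ satisfying the Chapman–Kolmogorov equations $\int_X p(s,x,u,z)p(u,z,t,y)\,dz=p(s,x,t,y)$ for all $x,y\in X$ and $s<u<t$. The Schrödinger perturbation of $p$ by $q$ is $\tilde p(s,x,t,y)=\sum_{n=0}^\infty p_n(s,x,t,y)$, $s<t$, where $p_0=p$ and $p_n(s,x,t,y)=\int_s^t\int_X p(s,x,u,z)q(u,z)p_{n-1}(u,z,t,y)\,dz\,du$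 for $n\ge1$. A function $Q\colon\mathbb{R}\times\mathbb{R}\to[0,\infty)$ is regular superadditive if $Q(s,u)+Q(u,t)\le Q(s,t)$ for $s<u<t$, $Q(s,t)=0$ if $s\ge t$, $s\mapsto Q(s,t)$ is right-continuous and $t\mapsto Q(s,t)$ is left-continuous. We write $q\in\mathcal{N}(p,p^*,C,\eta,Q)$ if $q\ge0$ is measurable on space-time, $p,p^*$ are measurable transition densities, $C\ge1$, $\eta\ge0$, $Q$ is regular superadditive, and for all $s<t$ and $x,y\in X$ both $p(s,x,t,y)\le C\,p^*(s,x,t,y)$ and $$\int_s^t\int_X p(s,x,u,z)q(u,z)p^*(u,z,t,y)\,dz\,du\le[\eta+Q(s,t)]\,p^*(s,x,t,y).$$ *)

(* Defs.v *)
From HB Require Import structures.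
From mathcomp Require Import all_boot all_order all_algebra.
From mathcomp Require Import all_classical all_reals all_analysis.
(* [measurable_realfun], which [all_analysis] does not re-export, provides the
   Borel sigma-algebra on \bar R. *)
From mathcomp Require Import measurable_realfun.

Set Implicit Arguments.
Unset Strict Implicit.
Unset Printing Implicit Defensive.

Import Order.TTheory GRing.Theory Num.Theory.
Import numFieldNormedType.Exports.

Local Open Scope classical_set_scope.
Local Open Scope ring_scope.
Local Open Scope ereal_scope.

(* Functions with values in [0, +oo] are \bar R-valued functions together with
   an explicit nonnegativity condition; products use the measure-theoretic
   convention 0 * +oo = 0, which is that of [mule]. The type [measurableTypeR R]
   is R with its Borel sigma-algebra. *)

Record measurable_transition_density (R : realType) (d : measure_display)
    (X : measurableType d) (m : {sigma_finite_measure set X -> \bar R})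
    (p : R -> X -> R -> X -> \bar R) : Prop := {
  mtd_ge0 : forall s x t y, 0 <= p s x t y ;
  mtd_measurable : measurable_fun [set: (measurableTypeR R * X) *
                                        (measurableTypeR R * X)]
    (fun a => p a.1.1 a.1.2 a.2.1 a.2.2) ;
  mtd_chapman_kolmogorov : forall (s u t : R) (x y : X),
    (s < u)%R -> (u < t)%R ->
    \int[m]_z (p s x u z * p u z t y) = p s x t y }.

(* p_n; only its values at s < t matter. The integral from s to t is taken over
   the open interval, so that p_n s x t y with s < t depends only on the values
   of p and p_(n-1) at increasing pairs of times. *)
Fixpoint schrodinger_term (R : realType) (d : measure_display)
    (X : measurableType d) (m : {sigma_finite_measure set X -> \bar R})
    (p : R -> X -> R -> X -> \bar R) (q : R -> X -> \bar R) (n : nat)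
    (s : R) (x : X) (t : R) (y : X) {struct n} : \bar R :=
  if n is k.+1 then
    \int[lebesgue_measure]_(u in `]s, t[)
      \int[m]_z (p s x u z * q u z * schrodinger_term m p q k u z t y)
  else p s x t y.

Definition schrodinger_perturbation (R : realType) (d : measure_display)
    (X : measurableType d) (m : {sigma_finite_measure set X -> \bar R})
    (p : R -> X -> R -> X -> \bar R) (q : R -> X -> \bar R)
    (s : R) (x : X) (t : R) (y : X) : \bar R :=
  \sum_(0 <= n <oo) schrodinger_term m p q n s x t y.

Record regular_superadditive (R : realType) (Q : R -> R -> R) : Prop := {
  rsa_ge0 : forall s t, (0 <= Q s t)%R ;
  rsa_superadditive : forall s u t,
    (s < u)%R -> (u < t)%R -> (Q s u + Q u t <= Q s t)%R ;
  rsa_eq0 : forall s t, (t <= s)%R -> Q s t = 0%R ;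
  rsa_right_continuous : forall s t, Q r t @[r --> s^'+] --> Q s t ;
  rsa_left_continuous : forall s t, Q s r @[r --> t^'-] --> Q s t }.

(* The class N(p, p^*, C, eta, Q), as a predicate on q. *)
Record relatively_bounded (R : realType) (d : measure_display)
    (X : measurableType d) (m : {sigma_finite_measure set X -> \bar R})
    (p pstar : R -> X -> R -> X -> \bar R) (C eta : R) (Q : R -> R -> R)
    (q : R -> X -> \bar R) : Prop := {
  rb_q_ge0 : forall u z, 0 <= q u z ;
  rb_q_measurable : measurable_fun [set: measurableTypeR R * X]
    (fun a => q a.1 a.2) ;
  rb_p : measurable_transition_density m p ;
  rb_pstar : measurable_transition_density m pstar ;
  rb_C : (1 <= C)%R ;
  rb_eta : (0 <= eta)%R ;
  rb_Q : regular_superadditive Q ;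
  rb_domination : forall (s t : R) (x y : X), (s < t)%R ->
    p s x t y <= C%:E * pstar s x t y ;
  rb_integral : forall (s t : R) (x y : X), (s < t)%R ->
    \int[lebesgue_measure]_(u in `]s, t[)
      \int[m]_z (p s x u z * q u z * pstar u z t y)
    <= (eta + Q s t)%:E * pstar s x t y }.

(* Main.v *)
Require Import Defs.
From HB Require Import structures.
From mathcomp Require Import all_boot all_order all_algebra.
From mathcomp Require Import all_classical all_reals all_analysis.
From mathcomp Require Import measurable_realfun lra.

(** Over a time interval on which [Q] is at most [eps], domination of [p] by
[C pstar] and the integral bound on [p q pstar] give by induction
[p_n <= C (eta + eps)^n pstar] ([schrodinger_term_le]), and the geometric
series yields the bound by [A pstar], with [A = C / (1 - eta - eps)].

A general interval from [s] to [t] is cut into short ones. Let [u] be the last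
time with [Q s u <= eps]; such a maximum exists by left continuity in the second
variable. Beyond [u] the value of [Q s] exceeds [eps], so superadditivity, and
right continuity in the first variable, give [Q u t <= Q s t - eps]
([regular_superadditive_split]). Each cut thus consumes [eps] of [Q s t], and at
most [1 + Q s t / eps] short intervals are used.

The bounds on the pieces multiply because the perturbation is again a transition
density: the [n]-th term over [s], [t] is the Cauchy product of the terms over
[s], [u] and [u], [t] integrated over the position at time [u]
([schrodinger_term_chapman_kolmogorov]). In probabilistic language, the [n]
interactions with [q] are distributed in all possible ways among the times
before and after [u]. The product [A pstar(s, u) * A^k pstar(u, t)] is then
integrated by the Chapman-Kolmogorov equation of [pstar]. Everything is done for
partial sums, and the number of terms goes to infinity only at the end. *)

Import Order.TTheory GRing.Theory Num.Theory.
Import numFieldNormedType.Exports.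

Local Open Scope classical_set_scope.
Local Open Scope ring_scope.
Local Open Scope ereal_scope.

(** * Integration over slabs of space-time *)

Definition slab {R : realType} {d} (X : measurableType d) (s t : R) :
  set (measurableTypeR R * X) := [set c | (s < c.1 < t)%R].

Lemma slabE {R : realType} {d} (X : measurableType d) (s t : R) :
  slab X s t = (`]s, t[%classic : set (measurableTypeR R)) `*` setT.
Proof.
by apply/seteqP; split=> -[u z]; rewrite /slab /= in_itv //= => -[].
Qed.

Lemma measurable_slab {R : realType} {d} (X : measurableType d) (s t : R) :
  measurable (slab X s t).
Proof.
by rewrite slabE; apply: measurableX => //; exact: measurable_itv.
Qed.

(** Products of the members of increasing exhaustions by sets of finite measure
exhaust the product space, because a point lies in both members as soon as the
index is large. *)
Lemma sigma_finite_product {R : realType} {d1 d2}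
    {T1 : measurableType d1} {T2 : measurableType d2}
    (m1 : {sigma_finite_measure set T1 -> \bar R})
    (m2 : {sigma_finite_measure set T2 -> \bar R}) :
  sigma_finite setT (m1 \x m2).
Proof.
have /sigma_finiteP[A [AT ndA Afin]] := sigma_finiteT m1.
have /sigma_finiteP[B [BT ndB Bfin]] := sigma_finiteT m2.
exists (fun n => A n `*` B n); last first.
  move=> n; have [[mA Aoo] [mB Boo]] := (Afin n, Bfin n).
  split; first exact: measurableX.
  by rewrite product_measure1E// lte_mul_pinfty// ge0_fin_numE.
apply/esym; rewrite -subTset => -[x y] _.
have [i _ Aix] : (\bigcup_n A n) x by rewrite -AT.
have [j _ Bjy] : (\bigcup_n B n) y by rewrite -BT.
exists (maxn i j) => //; split => /=.
  exact: (subsetPset _ _ (ndA _ _ (leq_maxl i j))) Aix.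
exact: (subsetPset _ _ (ndB _ _ (leq_maxr i j))) Bjy.
Qed.

(** A named constant, because canonical inference on [\x] itself selects the
sigma-finite structure of a product of subprobabilities. *)
Definition spacetime_measure {R : realType} {d} {X : measurableType d}
    (m : {sigma_finite_measure set X -> \bar R}) :
    set (measurableTypeR R * X)%type -> \bar R :=
  lebesgue_measure \x m.

HB.instance Definition _ {R : realType} {d} {X : measurableType d}
    (m : {sigma_finite_measure set X -> \bar R}) :=
  Measure.on (spacetime_measure m).

HB.instance Definition _ {R : realType} {d} {X : measurableType d}
    (m : {sigma_finite_measure set X -> \bar R}) :=
  Measure_isSigmaFinite.Build _ _ _ (spacetime_measure m)
    (sigma_finite_product lebesgue_measure m).

(** Tonelli's theorem in the form needed for kernels: composition of kernels is
associative. The set [D] becomes an indicator inside [f], so that the theorem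
applies on the whole product. *)
Lemma integral_swap {R : realType} {d1 d2}
    {T1 : measurableType d1} {T2 : measurableType d2}
    (m1 : {sigma_finite_measure set T1 -> \bar R})
    (m2 : {sigma_finite_measure set T2 -> \bar R}) (D : set T1)
    (f : T1 -> \bar R) (g : T1 -> T2 -> \bar R) (h : T2 -> \bar R) :
  measurable D ->
  measurable_fun setT f -> measurable_fun setT (fun a => g a.1 a.2) ->
  measurable_fun setT h ->
  (forall x, 0 <= f x) -> (forall x y, 0 <= g x y) -> (forall y, 0 <= h y) ->
  \int[m1]_(x in D) (f x * \int[m2]_y (g x y * h y)) =
  \int[m2]_y (\int[m1]_(x in D) (f x * g x y) * h y).
Proof.
move=> mD mf mg mh f0 g0 h0.
have mgx x : measurable_fun setT (g x) := measurable_fun_pair2 x mg.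
have mgy y : measurable_fun setT (g ^~ y) := measurable_fun_pair1 y mg.
pose F a : \bar R := (f \_ D) a.1 * (g a.1 a.2 * h a.2).
have fD0 x : 0 <= (f \_ D) x by apply: erestrict_ge0.
have F0 a : 0 <= F a by rewrite !mule_ge0.
have mfD : measurable_fun setT (f \_ D).
  by apply/(measurable_restrictT _ mD); exact: measurable_funTS.
have mF : measurable_fun setT F.
  apply: emeasurable_funM; first exact: measurableT_comp.
  by apply: emeasurable_funM => //; exact: measurableT_comp.
have FT := fubini_tonelli (m1 := m1) (m2 := m2) F mF F0.
rewrite integral_mkcond; transitivity (\int[m1]_x \int[m2]_y F (x, y)).
  apply: eq_integral => x _; rewrite /F /= patchE [in RHS]patchE.
  case: ifPn => _; last first.
    by under eq_integral do rewrite mul0e; rewrite integral0.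
  rewrite ge0_integralZl//; first exact: emeasurable_funM.
  by move=> y _; exact: mule_ge0.
rewrite FT /F /=; apply: eq_integral => y _.
under eq_integral do rewrite muleA.
rewrite ge0_integralZr//; last 2 first.
- exact: emeasurable_funM.
- by move=> x _; exact: mule_ge0.
congr (_ * _); rewrite [RHS]integral_mkcond; apply: eq_integral => x _.
by rewrite !patchE; case: ifP; rewrite ?mul0e.
Qed.

Lemma integral_slab {R : realType} {d} {X : measurableType d}
    (m : {sigma_finite_measure set X -> \bar R}) (s t : R)
    (f : measurableTypeR R * X -> \bar R) :
  measurable_fun setT f -> (forall c, 0 <= f c) ->
  \int[lebesgue_measure]_(u in `]s, t[) \int[m]_z f (u, z) =
  \int[spacetime_measure m]_(c in slab X s t) f c.
Proof.
move=> mf f0; rewrite [RHS]integral_mkcond fubini_tonelli1; last 2 first.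
- apply/(measurable_restrictT _ (measurable_slab X s t)).
  exact: measurable_funTS.
- by move=> c; exact: erestrict_ge0.
rewrite integral_mkcond; apply: eq_integral => u _; rewrite /fubini_F patchE.
have uE z : ((u, z) \in slab X s t) = (u \in `]s, t[%classic).
  by rewrite slabE in_setX in_setT andbT.
under [RHS]eq_integral => z _ do rewrite patchE uE.
by case: ifPn => // _; rewrite integral0.
Qed.

(** The slice at time [u] is negligible since a point has Lebesgue measure
zero. *)
Lemma integral_slab_split {R : realType} {d} {X : measurableType d}
    (m : {sigma_finite_measure set X -> \bar R}) (s u t : R)
    (f : measurableTypeR R * X -> \bar R) :
  (s < u)%R -> (u < t)%R ->
  measurable_fun setT f -> (forall c, 0 <= f c) ->
  \int[spacetime_measure m]_(c in slab X s t) f c =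
  \int[spacetime_measure m]_(c in slab X s u) f c +
  \int[spacetime_measure m]_(c in slab X u t) f c.
Proof.
move=> su ut mf f0; rewrite -!integral_slab//.
pose g v := \int[m]_z f (v, z).
have mg : measurable_fun [set: measurableTypeR R] g.
  exact: (measurable_fun_fubini_tonelli_F (m2 := m) f mf f0).
have g0 v : 0 <= g v by exact: integral_ge0.
rewrite [X in _ = X + _]integral_itv_bndo_bndc; last exact: measurable_funTS.
rewrite -ge0_integral_setU//.
- by rewrite -itv_bndbnd_setU// bnd_simp ltW.
- exact: measurable_funTS.
- by move=> v _; exact: g0.
- apply: lt_disjoint => v w; rewrite !in_itv/= => /andP[_ vu] /andP[uw _].
  exact: le_lt_trans uw.
Qed.

(** * Measurability and Chapman-Kolmogorov equations of the terms *)

Section terms.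
Context {R : realType} {d : measure_display} {X : measurableType d}.
Variable m : {sigma_finite_measure set X -> \bar R}.
Variables (p : R -> X -> R -> X -> \bar R) (q : R -> X -> \bar R).
Hypothesis p0 : forall s x t y, 0 <= p s x t y.
Hypothesis mp : measurable_fun [set: (measurableTypeR R * X) *
                                        (measurableTypeR R * X)]
    (fun a => p a.1.1 a.1.2 a.2.1 a.2.2).
Hypothesis q0 : forall u z, 0 <= q u z.
Hypothesis mq : measurable_fun [set: measurableTypeR R * X]
    (fun a => q a.1 a.2).

Local Notation P := (schrodinger_term m p q).
Local Notation T := (measurableTypeR R * X)%type.
Local Notation mu := (spacetime_measure m).

Lemma schrodinger_term_ge0 n s x t y : 0 <= P n s x t y.
Proof.
elim: n s x t y => [|n IH] s x t y //=.
by apply: integral_ge0 => u _; apply: integral_ge0 => z _; rewrite !mule_ge0.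
Qed.

Lemma measurable_forward (K : R -> X -> R -> X -> \bar R) (s : R) (x : X) :
  measurable_fun [set: T * T] (fun a => K a.1.1 a.1.2 a.2.1 a.2.2) ->
  measurable_fun [set: T] (fun c => K s x c.1 c.2).
Proof.
by move=> /(measurable_fun_pair2 (s, x)).
Qed.

Lemma measurable_backward (K : R -> X -> R -> X -> \bar R) (t : R) (y : X) :
  measurable_fun [set: T * T] (fun a => K a.1.1 a.1.2 a.2.1 a.2.2) ->
  measurable_fun [set: T] (fun c => K c.1 c.2 t y).
Proof.
by move=> /(measurable_fun_pair1 (t, y)).
Qed.

Lemma schrodinger_termS_slab n s x t y :
  measurable_fun [set: T * T] (fun a => P n a.1.1 a.1.2 a.2.1 a.2.2) ->
  P n.+1 s x t y =
  \int[mu]_(c in slab X s t) (p s x c.1 c.2 * q c.1 c.2 * P n c.1 c.2 t y).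
Proof.
move=> mP.
rewrite -(integral_slab m s t
  (fun c : T => p s x c.1 c.2 * q c.1 c.2 * P n c.1 c.2 t y))//.
- apply: emeasurable_funM; last exact: (measurable_backward (P n) t y).
  by apply: emeasurable_funM => //; exact: measurable_forward.
- by move=> c; rewrite !mule_ge0// schrodinger_term_ge0.
Qed.

Lemma measurable_schrodinger_term n :
  measurable_fun [set: T * T] (fun a => P n a.1.1 a.1.2 a.2.1 a.2.2).
Proof.
elim: n => [//|n IH].
(* The domain of integration depends on the end points, so the constraint on
   the intermediate time is moved into the integrand. *)
pose F (b : (T * T) * T) :=
  if (b.1.1.1 < b.2.1)%R && (b.2.1 < b.1.2.1)%R then
    p b.1.1.1 b.1.1.2 b.2.1 b.2.2 * q b.2.1 b.2.2 *
    P n b.2.1 b.2.2 b.1.2.1 b.1.2.2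
  else 0.
have m11 : measurable_fun [set: (T * T) * T] (fun b => b.1.1).
  exact: (measurableT_comp measurable_fst).
have m12 : measurable_fun [set: (T * T) * T] (fun b => b.1.2).
  exact: (measurableT_comp measurable_snd).
have m2 : measurable_fun [set: (T * T) * T] (fun b => b.2) := measurable_snd.
have mF : measurable_fun setT F.
  apply: measurable_fun_ifT => //.
    apply: measurable_and; apply: measurable_fun_ltr => //;
    exact: (measurableT_comp measurable_fst).
  apply: emeasurable_funM; first apply: emeasurable_funM.
  - exact: (measurableT_comp mp (measurable_fun_pair m11 m2)).
  - exact: (measurableT_comp mq m2).
  - exact: (measurableT_comp IH (measurable_fun_pair m2 m12)).
have F0 b : 0 <= F b.
  by rewrite /F; case: ifP => // _; rewrite !mule_ge0// schrodinger_term_ge0.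
suff -> : (fun a : T * T => P n.+1 a.1.1 a.1.2 a.2.1 a.2.2) = fubini_F mu F.
  exact: (measurable_fun_fubini_tonelli_F (m2 := mu) F mF F0).
apply/funext => a; rewrite schrodinger_termS_slab// integral_mkcond /fubini_F.
apply: eq_integral => c _; rewrite patchE /F /=.
by congr (if _ then _ else _); apply/idP/idP; rewrite ?inE.
Qed.

Hypothesis pCK : forall (s u t : R) (x y : X),
    (s < u)%R -> (u < t)%R ->
    \int[m]_z (p s x u z * p u z t y) = p s x t y.

Let mpq s x : measurable_fun [set: T] (fun c : T => p s x c.1 c.2 * q c.1 c.2).
Proof. by apply: emeasurable_funM => //; exact: measurable_forward. Qed.

Lemma measurable_fixed_final_time (K : R -> X -> R -> X -> \bar R) (u : R) :
  measurable_fun [set: T * T] (fun a => K a.1.1 a.1.2 a.2.1 a.2.2) ->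
  measurable_fun [set: T * X] (fun a => K a.1.1 a.1.2 u a.2).
Proof.
move=> mK.
apply: (measurableT_comp (f := fun a : T * T => K a.1.1 a.1.2 a.2.1 a.2.2) mK
  (g := fun a : T * X => (a.1, (u, a.2)))).
apply: measurable_fun_pair => //.
by apply: measurable_fun_pair => //; exact: measurable_cst.
Qed.

Lemma measurable_fixed_initial_time (K : R -> X -> R -> X -> \bar R) (u : R) :
  measurable_fun [set: T * T] (fun a => K a.1.1 a.1.2 a.2.1 a.2.2) ->
  measurable_fun [set: T * X] (fun a => K u a.2 a.1.1 a.1.2).
Proof.
move=> mK.
apply: (measurableT_comp (f := fun a : T * T => K a.1.1 a.1.2 a.2.1 a.2.2) mK
  (g := fun a : T * X => ((u, a.2), a.1))).
apply: measurable_fun_pair => //.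
by apply: measurable_fun_pair => //; exact: measurable_cst.
Qed.

(** By induction on [n], splitting the first interaction time [v] at [u]. If
[u < v], the first factor [p] passes through time [u] by its own
Chapman-Kolmogorov equation, which gives the summand [k = 0]. If [v < u], the
induction hypothesis applies to the remaining term started at [v], and the first
interaction is absorbed into [P k], which becomes [P k.+1]. *)
Lemma schrodinger_term_chapman_kolmogorov n (s u t : R) (x y : X) :
  (s < u)%R -> (u < t)%R ->
  P n s x t y = \sum_(k < n.+1) \int[m]_z (P k s x u z * P (n - k) u z t y).
Proof.
move=> su ut.
have P0 := schrodinger_term_ge0.
have mP := measurable_schrodinger_term.
have mPx k v w r : measurable_fun [set: X] (fun z => P k v w r z).
  exact: (measurable_fun_pair2 (v, w)
    (measurable_fixed_final_time (P k) r (mP k))).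
have mPz k v w r : measurable_fun [set: X] (fun z => P k r z v w).
  exact: (measurable_fun_pair2 (v, w)
    (measurable_fixed_initial_time (P k) r (mP k))).
elim: n s x su => [|n IH] s x su.
  by rewrite big_ord1 /= pCK.
pose f (c : T) := p s x c.1 c.2 * q c.1 c.2 * P n c.1 c.2 t y.
have mf : measurable_fun setT f.
  apply: emeasurable_funM => //.
  exact: (measurable_backward (P n) t y (mP n)).
have f0 c : 0 <= f c by rewrite !mule_ge0.
have -> : P n.+1 s x t y = \int[mu]_(c in slab X s u) f c +
                           \int[mu]_(c in slab X u t) f c.
  by rewrite schrodinger_termS_slab// (integral_slab_split m s u t).
have -> : \int[mu]_(c in slab X u t) f c =
    \int[m]_z (P 0%N s x u z * P n.+1 u z t y).
  transitivity (\int[mu]_(c in slab X u t)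
     (q c.1 c.2 * P n c.1 c.2 t y * \int[m]_z (p u z c.1 c.2 * p s x u z))).
    apply: eq_integral => c; rewrite inE /slab /= => /andP[uc ct].
    rewrite /f -(pCK s u c.1)// muleAC -[in LHS]muleA muleC.
    rewrite [P _ _ _ _ _ * _]muleC.
    by congr (_ * _); apply: eq_integral => z _; rewrite muleC.
  rewrite (integral_swap mu m (slab X u t)
     (fun c : T => q c.1 c.2 * P n c.1 c.2 t y) (fun (c : T) z => p u z c.1 c.2)
     (fun z => p s x u z))//.
  - apply: eq_integral => z _; rewrite muleC; congr (_ * _).
    rewrite schrodinger_termS_slab//; apply: eq_integral => c _.
    by rewrite muleC muleA.
  - exact: measurable_slab.
  - apply: emeasurable_funM => //.
    exact: (measurable_backward (P n) t y (mP n)).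
  - exact: measurable_fixed_initial_time.
  - exact: (mPx 0%N).
  - by move=> c; exact: mule_ge0.
rewrite [RHS]big_ord_recl addeC; congr (_ + _).
transitivity (\sum_(k < n.+1) \int[mu]_(c in slab X s u)
   (p s x c.1 c.2 * q c.1 c.2 *
     \int[m]_z (P k c.1 c.2 u z * P (n - k)%N u z t y))).
  rewrite -ge0_integral_sum//.
  - apply: eq_integral => c; rewrite inE /slab /= => /andP[sc cu].
    rewrite /f IH// ge0_sume_distrr// => k _.
    by apply: integral_ge0 => z _; exact: mule_ge0.
  - exact: measurable_slab.
  - move=> k; apply: measurable_funTS; apply: emeasurable_funM => //.
    pose G (a : T * X) := P k a.1.1 a.1.2 u a.2 * P (n - k)%N u a.2 t y.
    apply: (measurable_fun_fubini_tonelli_F (m2 := m) G).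
    + apply: emeasurable_funM; first exact: measurable_fixed_final_time.
      exact: measurableT_comp (mPz _ t y u) measurable_snd.
    + by move=> a; exact: mule_ge0.
  - move=> k c _; rewrite !mule_ge0//.
    by apply: integral_ge0 => z _; exact: mule_ge0.
apply: eq_bigr => k _.
rewrite (integral_swap mu m (slab X s u)
     (fun c : T => p s x c.1 c.2 * q c.1 c.2) (fun (c : T) z => P k c.1 c.2 u z)
     (fun z => P (n - k)%N u z t y))//.
- apply: eq_integral => z _; rewrite lift0 subSS.
  by rewrite [P k.+1 _ _ _ _]schrodinger_termS_slab.
- exact: measurable_slab.
- exact: measurable_fixed_final_time.
- by move=> c; exact: mule_ge0.
Qed.

End terms.

(** * Two elementary estimates of partial sums *)

(** The left-hand side sums the products [a i * b j] over the triangle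
[i + j < N], the right-hand side over the square [i, j < N]. *)
Lemma cauchy_product_partial_sum_le {R : realDomainType}
    (a b : nat -> \bar R) N :
  (forall n, 0 <= a n) -> (forall n, 0 <= b n) ->
  \sum_(n < N) \sum_(k < n.+1) a k * b (n - k)%N <=
  (\sum_(i < N) a i) * (\sum_(j < N) b j).
Proof.
move=> a0 b0; elim: N a a0 => [|N IH] a a0; first by rewrite !big_ord0 mul0e.
have b_ge0 M : 0 <= \sum_(j < M) b j by apply: sume_ge0.
under eq_bigr do rewrite big_ord_recl.
rewrite big_split /= -ge0_sume_distrr//.
rewrite [in leRHS]big_ord_recl ge0_muleDl//; last exact: sume_ge0.
rewrite leeD//.
  by rewrite lee_wpmul2l//; apply: lee_sum => i _; rewrite subn0.
rewrite big_ord_recl big_ord0 add0e.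
apply: le_trans (IH (fun n => a n.+1) (fun n => a0 n.+1)) _.
by rewrite lee_wpmul2l ?sume_ge0// [leRHS]big_ord_recr leeDl.
Qed.

Lemma geometric_partial_sum_le {R : realFieldType} (r : R) N :
  (0 <= r -> r < 1 -> \sum_(n < N) r ^+ n <= (1 - r)^-1)%R.
Proof.
move=> r0 r1; rewrite -div1r ler_pdivlMr ?subr_gt0// mulrC.
rewrite -opprB mulNr -subrX1 opprB gerBl exprn_ge0//.
Qed.

(** * Cutting an interval along a regular superadditive function *)

Section superadditive.
Context {R : realType}.
Variable Q : R -> R -> R.
Hypothesis hQ : regular_superadditive Q.

Lemma regular_superadditive_mono s u t : (s < u < t)%R -> (Q u t <= Q s t)%R.
Proof.
move=> /andP[su ut]; apply: le_trans (rsa_superadditive hQ su ut).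
by rewrite lerDr (rsa_ge0 hQ).
Qed.

(** Superadditivity bounds [Q s u] by [Q s t - Q u t], which tends to [0] as [u]
decreases to [s]. *)
Lemma regular_superadditive_small_near s t eps : (s < t)%R -> (0 < eps)%R ->
  exists2 u, (s < u < t)%R & (Q s u <= eps)%R.
Proof.
move=> st e0.
have /cvgrPdist_le/(_ _ e0) near_s := @rsa_right_continuous _ _ hQ s t.
have near_t : \forall u \near s^'+, (u < t)%R by exact: nbhs_right_lt.
have near_gt : \forall u \near s^'+, (s < u)%R by exact: nbhs_right_gt.
have [u [[ut su] Qu]] := filter_ex (filterI (filterI near_t near_gt) near_s).
exists u; first by rewrite su.
have := rsa_superadditive hQ su ut; move: Qu; rewrite ler_norml => /andP[_ Qu].
by rewrite -lerBrDr => /le_trans; apply.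
Qed.

(** The cut point is the supremum [u] of the times [r] with [Q s r <= eps]. Left
continuity keeps the bound at [u] itself; the bound on [Q u t] holds at the
times after [u] by superadditivity, and at [u] by right continuity. *)
Lemma regular_superadditive_split s t eps : (s < t)%R -> (0 < eps)%R ->
  (eps < Q s t)%R ->
  exists2 u, (s < u < t)%R & (Q s u <= eps)%R /\ (Q u t <= Q s t - eps)%R.
Proof.
move=> st e0 eQ.
pose A := [set r | (s < r < t)%R /\ (Q s r <= eps)%R].
have [u0 su0t Qu0] := regular_superadditive_small_near _ _ _ st e0.
have hsA : has_sup A.
  by split; [exists u0 | exists t => r [/andP[_ /ltW]]].
pose u := sup A.
have su : (s < u)%R.
  case/andP: (su0t) => su0 _; apply: lt_le_trans su0 _.
  by apply: ub_le_sup; [exact: hsA.2|].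
have ut : (u <= t)%R.
  by apply: ge_sup; [exact: hsA.1|move=> r [/andP[_ /ltW]]].
have Qsu : (Q s u <= eps)%R.
  have Q_lt r : (s < r < u)%R -> (Q s r <= eps)%R.
    move=> /andP[sr ru]; have [a [/andP[sa at_] Qa] ra] := sup_gt hsA.1 ru.
    apply: le_trans Qa; apply: le_trans (rsa_superadditive hQ sr ra).
    by rewrite lerDl (rsa_ge0 hQ).
  apply: (cvgr_to_le (@rsa_left_continuous _ _ hQ s u)).
  by near=> r; apply: Q_lt; apply/andP; split; near: r;
    [exact: nbhs_left_gt|exact: nbhs_left_lt].
have {}ut : (u < t)%R.
  by rewrite lt_neqAle ut andbT; apply: contraTneq Qsu => ->; rewrite -ltNge.
exists u; first by rewrite su.
split=> //.
have Q_gt r : (u < r < t)%R -> (Q r t <= Q s t - eps)%R.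
  move=> /andP[ur rt]; have sr := lt_trans su ur.
  have eQr : (eps < Q s r)%R.
    rewrite ltNge; apply/negP => Qr.
    have /(ub_le_sup hsA.2) : A r by split=> //; rewrite sr.
    by rewrite leNgt ur.
  have := rsa_superadditive hQ sr rt; lra.
apply: (cvgr_to_le (@rsa_right_continuous _ _ hQ u t)).
by near=> r; apply: Q_gt; apply/andP; split; near: r;
  [exact: nbhs_right_gt|exact: nbhs_right_lt].
Unshelve. all: by end_near. Qed.
End superadditive.

(** * Exponential bound on the perturbation *)

Section bounds.
Context {R : realType} {d : measure_display} {X : measurableType d}.
Variable m : {sigma_finite_measure set X -> \bar R}.
Variables (p pstar : R -> X -> R -> X -> \bar R) (q : R -> X -> \bar R).
Variables (C eta : R) (Q : R -> R -> R).
Hypothesis qN : relatively_bounded m p pstar C eta Q q.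

Local Notation P := (schrodinger_term m p q).
Local Notation T := (measurableTypeR R * X)%type.
Local Notation mu := (spacetime_measure m).

Let hp := rb_p qN.
Let hps := rb_pstar qN.
Let hQ := rb_Q qN.
Let p0 := mtd_ge0 hp.
Let ps0 := mtd_ge0 hps.
Let q0 := rb_q_ge0 qN.
Let mp := mtd_measurable hp.
Let mps := mtd_measurable hps.
Let mq := rb_q_measurable qN.
Let C0 : (0 <= C)%R := le_trans ler01 (rb_C qN).
Let P0 := schrodinger_term_ge0 m p q p0 q0.
Let mP := measurable_schrodinger_term m p q p0 mp q0 mq.

(** The constant [C] enters only once, through [p_0]: the later factors are
controlled by the integral bound, whose constant [eta + Q u t] is at most
[eta + Q s t]. *)
Lemma schrodinger_term_le n s x t y : (s < t)%R ->
  P n s x t y <= (C * (eta + Q s t) ^+ n)%:E * pstar s x t y.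
Proof.
elim: n s x => [|n IH] s x st.
  by rewrite expr0 mulr1; exact: (rb_domination qN x y st).
have M0 v w : (0 <= eta + Q v w)%R.
  by rewrite addr_ge0// ?(rb_eta qN) ?(rsa_ge0 hQ).
have c0 : (0 <= C * (eta + Q s t) ^+ n)%R by rewrite mulr_ge0// exprn_ge0.
pose g (c : T) := p s x c.1 c.2 * q c.1 c.2 * pstar c.1 c.2 t y.
have mpq : measurable_fun [set: T] (fun c : T => p s x c.1 c.2 * q c.1 c.2).
  by apply: emeasurable_funM => //; exact: (measurable_forward p s x mp).
have mg : measurable_fun setT g.
  by apply: emeasurable_funM => //; exact: (measurable_backward pstar t y mps).
have g0 c : 0 <= g c by rewrite !mule_ge0.
rewrite schrodinger_termS_slab//.
apply: (@le_trans _ _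
  (\int[mu]_(c in slab X s t) ((C * (eta + Q s t) ^+ n)%:E * g c))).
  apply: ge0_le_integral.
  - exact: measurable_slab.
  - by move=> c _; rewrite !mule_ge0.
  - apply: measurable_funTS; apply: emeasurable_funM => //.
    exact: (measurable_backward (P n) t y (mP n)).
  - by apply: measurable_funTS; exact: measurable_funeM.
  - move=> c /andP[sc ct]; rewrite /g muleCA lee_wpmul2l ?mule_ge0//.
    apply: le_trans (IH _ _ ct) _; rewrite lee_wpmul2r// lee_fin.
    rewrite ler_wpM2l// lerXn2r ?nnegrE//.
    by rewrite lerD2l (regular_superadditive_mono Q hQ)// sc.
rewrite ge0_integralZl_EFin//; last 2 first.
- exact: measurable_slab.
- exact: measurable_funTS.
rewrite -integral_slab// exprSr mulrA [in leRHS]EFinM -[leRHS]muleA.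
by apply: lee_wpmul2l => //; exact: (rb_integral qN x y st).
Qed.

Variable eps : R.
Hypothesis eps0 : (0 < eps)%R.
Hypothesis eps_lt : (eps < 1 - eta)%R.

Local Notation A := (C / (1 - eta - eps))%R.

Let A1 : (1 <= A)%R.
Proof.
rewrite ler_pdivlMr ?mul1r; last by rewrite subr_gt0.
have := rb_C qN; have := rb_eta qN; have := eps0; have := eps_lt; lra.
Qed.

Lemma schrodinger_partial_sum_le_short N s x t y :
  (s < t)%R -> (Q s t <= eps)%R ->
  \sum_(n < N) P n s x t y <= A%:E * pstar s x t y.
Proof.
move=> st Qe.
apply: (@le_trans _ _
  (\sum_(n < N) (C * (eta + Q s t) ^+ n)%:E * pstar s x t y)).
  by apply: lee_sum => n _; exact: schrodinger_term_le.
have M0 : (0 <= eta + Q s t)%R.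
  by rewrite addr_ge0// ?(rb_eta qN) ?(rsa_ge0 hQ).
rewrite -ge0_sume_distrl => [|n _]; last first.
  by rewrite lee_fin mulr_ge0// exprn_ge0.
rewrite lee_wpmul2r// sumEFin lee_fin -mulr_sumr ler_wpM2l//.
apply: le_trans (geometric_partial_sum_le _ N M0 _) _.
  by have := eps_lt; lra.
by rewrite lef_pV2 ?posrE; have := eps_lt; lra.
Qed.

(** Fewer than [N] interactions with [q] in total means fewer than [N] before and
fewer than [N] after time [u]. This submultiplicativity is what combines the
bounds on two adjacent intervals. *)
Lemma schrodinger_partial_sum_convolution N s u t x y :
  (s < u)%R -> (u < t)%R ->
  \sum_(n < N) P n s x t y <=
  \int[m]_z ((\sum_(i < N) P i s x u z) * (\sum_(j < N) P j u z t y)).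
Proof.
move=> su ut.
have mfw k : measurable_fun setT (fun z => P k s x u z).
  exact: (measurable_fun_pair2 u (measurable_forward (P k) s x (mP k))).
have mbw k : measurable_fun setT (fun z => P k u z t y).
  exact: (measurable_fun_pair2 u (measurable_backward (P k) t y (mP k))).
have mfb k l : measurable_fun setT (fun z => P k s x u z * P l u z t y).
  exact: emeasurable_funM.
under eq_bigr do rewrite (schrodinger_term_chapman_kolmogorov m p q p0 mp q0 mq
  (mtd_chapman_kolmogorov hp) _ s u t)//.
under eq_bigr => n _.
  rewrite -ge0_integral_sum//; last by move=> k z _; exact: mule_ge0.
  over.
rewrite -ge0_integral_sum//; last 2 first.
- by move=> n; apply: emeasurable_sum.
- by move=> n z _; apply: sume_ge0 => k _; exact: mule_ge0.
apply: ge0_le_integral => //.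
- move=> z _; apply: sume_ge0 => n _; apply: sume_ge0 => k _.
  exact: mule_ge0.
- by apply: emeasurable_sum => n; exact: emeasurable_sum.
- by apply: emeasurable_funM; exact: emeasurable_sum.
- move=> z _.
  exact: (cauchy_product_partial_sum_le (fun k => P k s x u z)
            (fun k => P k u z t y)).
Qed.

(** By induction on an integer bound of [Q s t / eps]: a cut at [u] contributes
one factor [A] and lowers [Q s t / eps] by at least one, so that the exponents
add up to at most [1 + Q s t / eps]. *)
Lemma schrodinger_partial_sum_le N s x t y : (s < t)%R ->
  \sum_(n < N) P n s x t y <= (A `^ (1 + Q s t / eps))%:E * pstar s x t y.
Proof.
have A0 : (0 < A)%R := lt_le_trans ltr01 A1.
have [k] : exists k : nat, (Q s t < k%:R * eps)%R.
  exists (Num.bound (Q s t / eps)); rewrite -ltr_pdivrMr//.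
  by apply: archi_boundP; rewrite divr_ge0 ?(rsa_ge0 hQ)// ltW.
elim: k s x => [|k IH] s x Qk st.
  by move: Qk; rewrite mul0r ltNge (rsa_ge0 hQ).
have [Qe|eQ] := leP (Q s t) eps.
  apply: le_trans (schrodinger_partial_sum_le_short _ _ _ _ _ st Qe) _.
  rewrite lee_wpmul2r// lee_fin -[leLHS]powRr1 ?ler_powR// ?(ltW A0)//.
  by rewrite lerDl divr_ge0 ?(rsa_ge0 hQ)// ltW.
have [u /andP[su ut] [Qsu Qut]] :=
  regular_superadditive_split Q hQ _ _ _ st eps0 eQ.
have Qk' : (Q u t < k%:R * eps)%R.
  by move: Qk; rewrite -natr1 mulrDl mul1r; lra.
apply: le_trans (schrodinger_partial_sum_convolution _ _ _ _ _ _ su ut) _.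
pose B := (A `^ (1 + Q u t / eps))%R.
have B0 : (0 <= B)%R := powR_ge0 _ _.
have mf : measurable_fun setT (fun z => pstar s x u z * pstar u z t y).
  apply: emeasurable_funM.
    exact: (measurable_fun_pair2 u (measurable_forward pstar s x mps)).
  exact: (measurable_fun_pair2 u (measurable_backward pstar t y mps)).
apply: (@le_trans _ _
  (\int[m]_z ((A * B)%:E * (pstar s x u z * pstar u z t y)))).
  apply: ge0_le_integral => //.
  - by move=> z _; rewrite mule_ge0// sume_ge0.
  - apply: emeasurable_funM; apply: emeasurable_sum => k0.
      exact: (measurable_fun_pair2 u (measurable_forward (P k0) s x (mP k0))).
    exact: (measurable_fun_pair2 u (measurable_backward (P k0) t y (mP k0))).
  - exact: measurable_funeM.
  - move=> z _; rewrite EFinM muleACA; apply: lee_pmul; rewrite ?sume_ge0//.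
      exact: schrodinger_partial_sum_le_short.
    exact: IH.
rewrite ge0_integralZl_EFin//; last 2 first.
- by move=> z _; exact: mule_ge0.
- by rewrite mulr_ge0// ltW.
rewrite (mtd_chapman_kolmogorov hps)// lee_wpmul2r// lee_fin.
rewrite -[X in (X * B)%R]powRr1 ?(ltW A0)// -powRD; last first.
  by rewrite (gt_eqF A0) implybT.
rewrite ler_powR// lerD2l ler_pdivlMr// mulrDl mul1r divfK ?gt_eqF//.
by rewrite addrC -lerBrDr.
Qed.
End bounds.

Theorem theorem1p1 (R : realType) (d : measure_display) (X : measurableType d)
    (m : {sigma_finite_measure set X -> \bar R})
    (p pstar : R -> X -> R -> X -> \bar R) (q : R -> X -> \bar R)
    (C eta : R) (Q : R -> R -> R)
    (eta_lt1 : (eta < 1)%R)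
    (qN : relatively_bounded m p pstar C eta Q q) :
  forall (s t : R) (x y : X) (eps : R),
    (s < t)%R -> (0 < eps)%R -> (eps < 1 - eta)%R ->
    schrodinger_perturbation m p q s x t y
    <= pstar s x t y
       * ((C / (1 - eta - eps)) `^ (1 + Q s t / eps))%:E.
Proof.
move=> s t x y eps st eps0 eps_lt; rewrite /schrodinger_perturbation muleC.
apply: lime_le.
  apply: is_cvg_nneseries => n _ _; apply: schrodinger_term_ge0 => //.
    exact: (mtd_ge0 (rb_p qN)).
  exact: rb_q_ge0 qN.
apply: nearW => N; rewrite big_mkord.
exact: (schrodinger_partial_sum_le m p pstar q C eta Q qN eps eps0 eps_lt).
Qed.
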